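(* Let $n$ be a positive integer with $n\equiv 16 \pmod{24}$. Then there exists a configuration $(2,4)$ $GDD\left(n,2,6;\frac{7n}{8},n-1\right)$.
   Context: A $GDD(n,2,6;\lambda_1,\lambda_2)$ is a finite collection (repetitions allowed) of $6$-element subsets, called blocks, of a $2n$-element set $X$ partitioned into two groups of size $n$, such that every point lies in the same number $r$ of blocks, any two distinct points of the same group lie together in exactly $\lambda_1$ blocks, and any two points from different groups lie together in exactly $\lambda_2$ blocks. It has configuration $(2,4)$ if every block has exactly $2$ points in one of the two groups and $4$ points in the other (which group contains the $2$ points may depend on the block). *)

(* Defs.v *)
From mathcomp Require Import all_boot.

Set Implicit Arguments.
Unset Strict Implicit.
Unset Printing Implicit Defensive.

(* A GDD(n, m, k; l1, l2) whose points are all the elements of T: [groups] is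
   the set of groups, and the collection of blocks is a sequence because blocks
   may be repeated. *)
Record is_GDD (n m k l1 l2 : nat) (T : finType)
    (groups : {set {set T}}) (blocks : seq {set T}) : Prop := IsGDD {
  gdd_card_points : #|T| = m * n;
  gdd_partition : partition groups [set: T];
  gdd_card_groups : #|groups| = m;
  gdd_card_group : forall G, G \in groups -> #|G| = n;
  gdd_card_block : forall b, b \in blocks -> #|b| = k;
  gdd_replication : exists r : nat,
    forall x : T, count (fun b : {set T} => x \in b) blocks = r;
  gdd_same_group : forall (G : {set T}) (x y : T),
    G \in groups -> x \in G -> y \in G -> x != y ->
    count (fun b : {set T} => (x \in b) && (y \in b)) blocks = l1;
  gdd_diff_group : forall (G H : {set T}) (x y : T),
    G \in groups -> H \in groups -> G != H -> x \in G -> y \in H ->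
    count (fun b : {set T} => (x \in b) && (y \in b)) blocks = l2
}.

(* Meant for designs with exactly two groups. *)
Definition has_configuration (s t : nat) (T : finType)
    (groups : {set {set T}}) (blocks : seq {set T}) : Prop :=
  forall b, b \in blocks ->
    exists G H : {set T},
      [/\ G \in groups, H \in groups, G != H,
          #|b :&: G| = s & #|b :&: H| = t].

(* Main.v *)
(* Write n = q f with q a power of 2 (q >= 8) and f coprime to 6, and take two copies
   of F_q x Z_f as groups.  Every block is a quadruple Q of one copy together with a
   pair P of the other copy.

   For f = 1, an unordered pair {x, y} of F_q gives P = {x, y} and
   Q = {x + c (x - y), y + c (y - x) | c = c0, c1}.  When c0 and c1 are generic, any two
   of these six affine forms determine (x, y), so every pair of distinct points lies
   in 6 quadruples and in 1 pair, and two points a, b are joined by 4 blocks with a in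
   Q and b in P if a <> b, by none if a = b.  Taking c0 = 0 makes P a part of Q, which
   turns these last numbers into 3 and q - 1: a single such family, against 2u - 1
   generic ones (u = n / 8), brings all mixed pairs to n - 1.

   For general f every such block is inflated by the rows of an orthogonal array on
   Z_f with six columns.  Then only the pairs of points in a common fibre {g} x Z_f are
   not yet covered often enough, and these are completed by the same construction on
   Z_f with coefficients 0 and 1, in which P is moreover translated freely. *)

Require Import Defs.
From mathcomp Require Import all_boot.
From mathcomp Require Import all_algebra all_field.
From mathcomp Require Import zify.

Import GRing.Theory.

Set Implicit Arguments.
Unset Strict Implicit.
Unset Printing Implicit Defensive.

(** * Sums of indicators and counts in sequences *)

Lemma sum_pred1 (T : finType) (x : T) : \sum_(y : T) (y == x) = 1.
Proof. by rewrite (bigD1 x) //= eqxx big1 // => y /negbTE->. Qed.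

Lemma sum_predC1 (T : finType) (x : T) : \sum_(y : T) (y != x) = #|T|.-1.
Proof. by rewrite -big_mkcond /= sum1_card cardC1. Qed.

Lemma mem_imset_sum (I T : finType) (S : {pred I}) (h : I -> T) (x : T) :
  {in S &, injective h} -> (x \in [set h i | i in S]) = \sum_(i in S) (h i == x) :> nat.
Proof.
move=> hI; case: imsetP => [[i Si ->]|nx].
  rewrite (bigD1 i) //= eqxx big1 // => j /andP[Sj jDi].
  by case: eqP => // /hI e; rewrite e ?eqxx in jDi.
rewrite big1 // => i Si; case: eqP => // e; by case: nx; exists i.
Qed.

Lemma count_flatten_nseq (T : Type) (p : pred T) (m : nat) (s : seq T) :
  count p (flatten (nseq m s)) = m * count p s.
Proof. by rewrite count_flatten map_nseq sumn_nseq mulnC. Qed.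

Lemma mem_flatten_nseq (T : eqType) (m : nat) (s : seq T) (x : T) :
  x \in flatten (nseq m s) -> x \in s.
Proof. by case/flattenP=> s' /nseqP[-> _]. Qed.

(** * Unordered pairs as increasing ordered pairs *)

Section IncreasingPairs.

Variable V : finType.

(* Selects one of the two orderings of an unordered pair. *)
Definition increasing (e : V * V) : bool := enum_rank e.1 < enum_rank e.2.
Definition flip (e : V * V) : V * V := (e.2, e.1).

(** [flip] exchanges increasing and decreasing pairs, and a pair with distinct entries is exactly
    one of the two. *)
Lemma sum_increasing (phi : V * V -> nat) :
  (forall e, phi (flip e) = phi e) ->
  \sum_(e | e.1 != e.2) phi e = (\sum_(e | increasing e) phi e).*2.
Proof.
move=> phiC; rewrite (bigID increasing) /= -addnn; congr addn.
  apply: eq_bigl => e; rewrite andbC /increasing; case: ltnP => //= lt12.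
  by apply: contraTneq lt12 => ->; rewrite ltnn.
rewrite (reindex_inj (h := flip)) /=; last by case=> a b [c d] [-> ->].
apply: eq_big => e; last by rewrite phiC.
rewrite /increasing /= -leqNgt leq_eqVlt andb_orr eq_sym.
have -> : (e.1 != e.2) && (enum_rank e.1 == enum_rank e.2 :> nat) = false.
  by apply/negP=> /andP[/eqP ne /eqP/val_inj/enum_rank_inj].
rewrite /=; case: ltnP; rewrite ?andbF ?andbT // => lt12.
by apply: contraTneq lt12 => ->; rewrite ltnn.
Qed.

End IncreasingPairs.

(* A column (k, b) is a point of a block: it lies in the quadruple if k < 2 and in the
   pair if k = 2, while b tells which of x, y comes first in its affine form. *)
Notation column := ('I_3 * bool)%type.
Definition cols (K : pred 'I_3) : pred column := [pred i | K i.1].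

(** * Affine forms in a pair of points and their incidence counts *)

Section Forms.

Variables (V : finZmodType) (d : 'I_3 -> V -> V) (co : rel 'I_3).

(** [d k] stands for multiplication by c_k; as an abstract map it serves both the field and Z_f.
    [co] records which coefficients agree, and the injectivity hypotheses below say that c_k - c_l
    and 1 + c_k + c_l can be cancelled. *)
Definition affine_form (i : column) (e : V * V) : V :=
  let p := if i.2 then flip e else e in (p.1 + d i.1 (p.1 - p.2))%R.

Definition same_form (i j : column) : bool := (i.2 == j.2) && co i.1 j.1.

Hypothesis dN : forall k w, d k (- w)%R = (- d k w)%R.
Hypothesis d0 : forall k, d k 0%R = 0%R.
Hypothesis coE : forall k l, co k l -> d k =1 d l.
Hypothesis d_inj : forall k l, ~~ co k l -> injective (fun w => d k w - d l w)%R.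
Hypothesis d1_inj : forall k l, injective (fun w => w + d k w + d l w)%R.

Lemma form_diag i x : affine_form i (x, x) = x.
Proof. by rewrite /affine_form; case: i.2; rewrite /= subrr d0 addr0. Qed.

Lemma form_flip k b e : affine_form (k, ~~ b) (flip e) = affine_form (k, b) e.
Proof. by case: e b => x y []. Qed.

Lemma form_sub k l b (e : V * V) :
  (affine_form (k, b) e - affine_form (l, b) e)%R =
  (fun w => d k w - d l w)%R (if b then e.2 - e.1 else e.1 - e.2)%R.
Proof. by rewrite /affine_form; case: b => /=; rewrite opprD addrACA subrr add0r. Qed.

Lemma form_subN k l (e : V * V) :
  (affine_form (k, false) e - affine_form (l, true) e)%R =
  (fun w => w + d k w + d l w)%R (e.1 - e.2)%R.
Proof.
rewrite /affine_form /= -[(e.2 - e.1)%R]opprB dN opprD opprK.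
by rewrite addrACA addrA.
Qed.

(** The difference of the two values depends on x - y alone, through one of the maps assumed
    injective; once x - y is known, a single value gives x or y. *)
Lemma form_inj i j :
  ~~ same_form i j -> injective (fun e => (affine_form i e, affine_form j e)).
Proof.
move=> nij [x y] [x' y'] [ei ej].
suff w_eq : (x - y = x' - y')%R.
  have w_eq' : (y - x = y' - x')%R by rewrite -opprB w_eq opprB.
  move: ei; rewrite /affine_form; case: i.2 => /=; rewrite ?w_eq ?w_eq' => /addIr e1.
    by move: w_eq; rewrite e1 => /addIr->.
  by move: w_eq; rewrite e1 => /addrI/oppr_inj->.
case: i j nij ei ej => [k b] [l c]; rewrite /same_form /=.
have [<- /= nco|] := eqVneq b c.
  move=> ek el; have := congr2 (fun u v => u - v)%R ek el; rewrite !form_sub => /(d_inj nco).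
  by case: (b) => //= /(congr1 (@GRing.opp V)); rewrite !opprB.
case: b c => [] [] //= _ _ ek el.
  by have := congr2 (fun u v => u - v)%R el ek; rewrite !form_subN => /d1_inj.
by have := congr2 (fun u v => u - v)%R ek el; rewrite !form_subN => /d1_inj.
Qed.

Lemma same_formE i j : same_form i j -> affine_form i =1 affine_form j.
Proof.
by case: i j => [k b] [l c] /andP[/= /eqP<- /coE kl] e; rewrite /affine_form /= kl.
Qed.

Definition incidence (i j : column) (x y : V) (e : V * V) : nat :=
  (affine_form i e == x) * (affine_form j e == y).

(** The two forms together permute V x V and fix every diagonal pair, hence they permute the
    off-diagonal pairs. *)
Lemma sum_incidence_neq i j x y : ~~ same_form i j ->
  \sum_(e | e.1 != e.2) incidence i j x y e = (x != y).
Proof.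
move=> nij; pose h e := (affine_form i e, affine_form j e).
have hI : injective h by exact: form_inj.
have [g gK hK] := injF_bij hI.
have [<-|xy] := eqVneq x y.
  rewrite big1 // => e ne; rewrite /incidence.
  case: eqP => //= ei; case: eqP => //= ej; case/eqP: ne.
  have /hI-> // : h e = h (x, x) by rewrite /h ei ej !form_diag.
rewrite (bigD1 (g (x, y))) /=.
  have [e1 e2] : h (g (x, y)) = (x, y) by rewrite hK.
  rewrite /incidence e1 e2 !eqxx big1 // => e /andP[_ neq].
  case: eqP => //= ei; case: eqP => //= ej; case/eqP: neq.
  by apply: hI; rewrite hK /h ei ej.
apply: contra xy => /eqP eg; have := hK (x, y); case: (g _) eg => a b /= ->.
by rewrite /h !form_diag => -[<- <-].
Qed.

Lemma sum_form k b x :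
  \sum_(e : V * V | e.1 != e.2) (affine_form (k, b) e == x) = #|V|.-1.
Proof.
(* The form of opposite orientation is never [same_form], so its value y sorts the pairs e: one for
   each y other than x. *)
have inc e : (affine_form (k, b) e == x : nat) = \sum_(y : V) incidence (k, b) (k, ~~ b) x y e.
  rewrite /incidence -big_distrr /=; under eq_bigr => y _ do rewrite eq_sym.
  by rewrite sum_pred1 muln1.
rewrite -(sum_predC1 x); under [LHS]eq_bigr => e _ do rewrite inc.
rewrite exchange_big /=; apply: eq_bigr => y _.
by rewrite eq_sym sum_incidence_neq //; case: b {inc}.
Qed.

Lemma sum_incidence i j x y :
  \sum_(e | e.1 != e.2) incidence i j x y e =
  if same_form i j then ((x == y) * #|V|.-1)%N else (x != y).
Proof.
case: ifPn => [ij|]; last exact: sum_incidence_neq.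
case: i ij => k b ij.
rewrite -(sum_form k b x) big_distrr /=; apply: eq_bigr => e _.
rewrite /incidence -(same_formE ij); case: (eqVneq _ x) => [->|_]; last by rewrite muln0.
by rewrite mulnC.
Qed.

(** Counts pairs of columns rather than blocks; the two agree once the columns of a block give
    distinct points, see [sum_column_image]. *)
Definition pair_count (K K' : pred 'I_3) (x y : V) : nat :=
  \sum_(i in cols K) \sum_(j in cols K' | j != i)
    \sum_(e | increasing e) incidence i j x y e.

(** The sum over all columns does not see the order of e, so ordered pairs give exactly twice the
    count, and over these [sum_incidence] applies. *)
Lemma double_pair_count K K' x y :
  (pair_count K K' x y).*2 =
  \sum_(i in cols K) \sum_(j in cols K' | j != i)
    (if same_form i j then ((x == y) * #|V|.-1)%N else (x != y)).
Proof.
under [RHS]eq_bigr => i _ do under eq_bigr => j _ do rewrite -sum_incidence.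
rewrite /pair_count.
pose phi e := \sum_(i in cols K) \sum_(j in cols K' | j != i) incidence i j x y e.
transitivity (\sum_(e | increasing e) phi e).*2.
  by congr _.*2; rewrite [RHS]exchange_big; apply: eq_bigr => i _; rewrite [RHS]exchange_big.
rewrite -sum_increasing.
  by rewrite exchange_big; apply: eq_bigr => i _; rewrite exchange_big.
(* Flipping e and reversing the orientation bit of every column leaves all forms unchanged. *)
move=> e; pose t (i : column) := (i.1, ~~ i.2).
have tI : injective t by case=> a b [a' b'] [-> /negb_inj->].
have tf i : affine_form (t i) (flip e) = affine_form i e by case: i => k b; rewrite form_flip.
rewrite /phi (reindex_inj tI) /=; apply: eq_bigr => i _.
rewrite (reindex_inj tI) /=; apply: eq_big => j; first by rewrite (inj_eq tI).
by move=> _; rewrite /incidence !tf.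
Qed.

End Forms.

(** * Explicit counts for three coefficients *)

Definition quad_index : pred 'I_3 := fun k => k < 2.
Definition duo_index : pred 'I_3 := fun k => k == 2 :> nat.

(* Two coefficients c_k, c_l agree iff k = l modulo m: all three are distinct for m = 3,
   and only c_0 = c_2 coincide for m = 2. *)
Definition congruent_index (m : nat) (k l : 'I_3) : bool := k == l %[mod m].

(** Brings sums over columns into a form that [big_ord_recl] and [big_bool] expand into explicit
    terms. *)
Lemma sum_cols (K : pred 'I_3) (P : pred column) (G : column -> nat) :
  \sum_(i in cols K | P i) G i =
  \sum_(k < 3) \sum_(b : bool) (if K k && P (k, b) then G (k, b) else 0).
Proof. by rewrite pair_bigA big_mkcond /=; apply: eq_bigr => -[k b] _. Qed.

Lemma sum_cols_neq (K K' : pred 'I_3) (G : column -> column -> nat) :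
  \sum_(i in cols K) \sum_(j in cols K' | j != i) G i j =
  \sum_(k < 3) \sum_(b : bool) (if K k && true then
    \sum_(l < 3) \sum_(c : bool)
      (if K' l && ((l, c) != (k, b)) then G (k, b) (l, c) else 0) else 0).
Proof.
rewrite -(eq_bigl _ _ (fun i => andbT (i \in cols K))) sum_cols.
by apply: eq_bigr => k _; apply: eq_bigr => b _; rewrite sum_cols.
Qed.

Section FormCounts.

Variables (V : finZmodType) (d : 'I_3 -> V -> V) (m : nat).
Hypothesis dN : forall k w, d k (- w)%R = (- d k w)%R.
Hypothesis d0 : forall k, d k 0%R = 0%R.
Hypothesis coE : forall k l, congruent_index m k l -> d k =1 d l.
Hypothesis d_inj : forall k l, ~~ congruent_index m k l ->
  injective (fun w => d k w - d l w)%R.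
Hypothesis d1_inj : forall k l, injective (fun w => w + d k w + d l w)%R.

Let double K K' x y := double_pair_count dN d0 coE d_inj d1_inj K K' x y.

(** c_0 and c_1 differ for either m, so each of the 12 ordered pairs of distinct quadruple columns
    contributes 1 when x <> y; halving leaves 6. *)
Lemma pair_count_quad x y : (m == 2) || (m == 3) ->
  pair_count d quad_index quad_index x y = 6 * (x != y).
Proof.
move=> m23; apply: double_inj; rewrite double.
rewrite sum_cols_neq.
rewrite !(big_ord_recl, big_ord0) !big_bool /= !(big_ord_recl, big_ord0) !big_bool /=.
by case/orP: m23 => /eqP->; rewrite /same_form /congruent_index /=; case: eqP.
Qed.

Lemma pair_count_duo x y : pair_count d duo_index duo_index x y = (x != y).
Proof.
apply: double_inj; rewrite double.
rewrite sum_cols_neq.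
rewrite !(big_ord_recl, big_ord0) !big_bool /= !(big_ord_recl, big_ord0) !big_bool /=.
by rewrite /same_form /=; case: eqP.
Qed.

Lemma pair_count_mixed3 x y : m = 3 ->
  pair_count d quad_index duo_index x y = 4 * (x != y).
Proof.
move=> m3; apply: double_inj; rewrite double.
rewrite sum_cols_neq.
rewrite !(big_ord_recl, big_ord0) !big_bool /= !(big_ord_recl, big_ord0) !big_bool /=.
by rewrite m3 /same_form /congruent_index /=; case: eqP.
Qed.

(** Of the 8 column pairs, the two joining index 0 to index 2 with equal orientation carry the same
    form and contribute only for x = y; the other six contribute only for x <> y. *)
Lemma pair_count_mixed2 x y : m = 2 ->
  pair_count d quad_index duo_index x y = if x == y then #|V|.-1 else 3.
Proof.
move=> m2; apply: double_inj; rewrite double.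
rewrite sum_cols_neq.
rewrite !(big_ord_recl, big_ord0) !big_bool /= !(big_ord_recl, big_ord0) !big_bool /=.
rewrite m2 /same_form /congruent_index /=; case: eqP => //= _.
by rewrite !mul1n !addn0 !add0n addnn.
Qed.

(** Summed over y, a column pair gives |V| - 1 whether or not its two forms coincide, so only the
    number 8 of column pairs matters. *)
Lemma sum_pair_count_mixed x :
  \sum_y pair_count d quad_index duo_index x y = 4 * #|V|.-1.
Proof.
apply: double_inj; rewrite -muln2 big_distrl /=.
under eq_bigr => y _ do rewrite muln2 double.
rewrite exchange_big /=.
have sumE (c : bool) : \sum_y (if c then (x == y) * #|V|.-1 else (x != y)) = #|V|.-1.
  case: c; last by rewrite -[RHS](sum_predC1 x); apply: eq_bigr => y _; rewrite eq_sym.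
  rewrite -big_distrl /= -[RHS]mul1n -[in RHS](sum_pred1 x).
  by congr muln; apply: eq_bigr => y _; rewrite eq_sym.
under eq_bigr => i _.
  rewrite exchange_big /=; under eq_bigr => j _ do rewrite sumE.
  over.
rewrite sum_cols_neq.
rewrite !(big_ord_recl, big_ord0) !big_bool /= !(big_ord_recl, big_ord0) !big_bool /=.
lia.
Qed.

End FormCounts.

(** * Families of blocks given by their columns *)

Section Families.

Variables (X J : finType) (U : pred J) (pt : column -> J -> X).

Definition column_image (K : pred 'I_3) (t : J) : {set X} := [set pt i t | i in cols K].

Definition block_family : seq ({set X} * {set X}) :=
  [seq (column_image quad_index t, column_image duo_index t) | t <- enum U].

Lemma count_block_family (p : pred ({set X} * {set X})) :
  count p block_family = \sum_(t in U) p (column_image quad_index t, column_image duo_index t).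
Proof.
rewrite count_map -sum1_count big_enum_cond /= big_mkcondr /=.
by apply: eq_bigr => t _; case: (p _).
Qed.

(** By injectivity, membership in a block is a sum of indicators over columns. Terms with i = j
    vanish: a shared column would force x = y. *)
Lemma sum_column_image (K K' : pred 'I_3) (x y : X) :
  (forall t, t \in U -> {in cols K &, injective (pt^~ t)}) ->
  (forall t, t \in U -> {in cols K' &, injective (pt^~ t)}) ->
  (forall k, K k -> K' k -> x != y) ->
  \sum_(t in U) ((x \in column_image K t) && (y \in column_image K' t)) =
  \sum_(i in cols K) \sum_(j in cols K' | j != i)
    \sum_(t in U) (pt i t == x) * (pt j t == y).
Proof.
move=> ptI ptI' xy.
rewrite [RHS](_ : _ = \sum_(t in U) \sum_(i in cols K)
  \sum_(j in cols K' | j != i) (pt i t == x) * (pt j t == y)); last first.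
  by rewrite [RHS]exchange_big; apply: eq_bigr => i _; rewrite [RHS]exchange_big.
apply: eq_bigr => t Ut.
rewrite -mulnb (mem_imset_sum _ (ptI t Ut)) (mem_imset_sum _ (ptI' t Ut)).
rewrite big_distrl /=; apply: eq_bigr => i Ki; rewrite big_distrr /=.
rewrite [LHS](bigID (fun j => j != i)) /= [X in _ + X]big1 ?addn0 // => j.
rewrite negbK => /andP[K'j /eqP eji]; subst j.
case: eqP => //= ex; case: eqP => //= ey.
by have := xy _ Ki K'j; rewrite -ex -ey eqxx.
Qed.

End Families.

(** * An orthogonal array of strength 2 with six columns *)

Section OrthogonalArray.

Variable Z : finZmodType.
Hypothesis mulrn_inj : forall k, 0 < k < 5 -> injective (fun z : Z => z *+ k)%R.

(** A row is a line: columns 0 to 4 hold its values there and column 5 its slope. Thus only the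
    differences 1 to 4 have to be cancelled, and 5 may divide the order of Z. *)
Definition oa (i : column) (r : Z * Z) : Z :=
  let m := 2 * i.1 + i.2 in if m == 5 then r.2 else (r.1 + r.2 *+ m)%R.

Lemma oa_inj i j : i != j -> injective (fun r => (oa i r, oa j r)).
Proof.
pose g m (r : Z * Z) := if m == 5 then r.2 else (r.1 + r.2 *+ m)%R.
have gI m m' : m < m' < 6 -> injective (fun r => (g m r, g m' r)).
  case/andP=> mm' m'6 [a b] [a' b'] []; rewrite /g /=.
  rewrite (_ : m == 5 = false); last by lia.
  case: eqVneq => [_ e1 e2|m'5 e1 e2]; first by move: e1; rewrite e2 => /addIr->.
  suff bb : b = b' by move: e1; rewrite bb => /addIr->.
  apply: (@mulrn_inj (m' - m)); first by lia.
  have := congr2 (fun u v => u - v)%R e2 e1.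
  have subE p q r : (p + q - (p + r) = q - r :> Z)%R.
    by rewrite opprD addrACA subrr add0r.
  by rewrite !subE -!mulrnBr // ltnW.
case: i j => [k b] [l c] ne.
have [lt|lt|eq] := ltngtP (2 * k + b) (2 * l + c).
- by apply: (gI _ _ _); have := ltn_ord l; case: c {ne} lt => /=; lia.
- have h : 2 * l + c < 2 * k + b < 6.
    by have := ltn_ord k; case: b {ne} lt => /=; lia.
  by move=> r r' [e1 e2]; apply: (gI _ _ h); congr pair; [exact: e2|exact: e1].
case/eqP: ne; have kl : k = l :> nat by case: b c eq => [] [] /=; lia.
rewrite (val_inj kl); congr pair.
by move: eq; rewrite kl; case: b c => [] [] //=; lia.
Qed.

Lemma sum_oa i j z z' : i != j -> \sum_r (oa i r == z) * (oa j r == z') = 1.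
Proof.
move=> /oa_inj hI; rewrite -(sum_pred1 (z, z')) [RHS](reindex_inj hI) /=.
by apply: eq_bigr => r _; rewrite mulnb -xpair_eqE.
Qed.

End OrthogonalArray.

(** * Inflation by the array, and filling of the fibres *)

Section InflatedFamilies.

Variables (V Z : finZmodType) (d : 'I_3 -> V -> V) (m : nat).
Hypothesis m23 : (m == 2) || (m == 3).
Hypothesis dN : forall k w, d k (- w)%R = (- d k w)%R.
Hypothesis d0 : forall k, d k 0%R = 0%R.
Hypothesis coE : forall k l, congruent_index m k l -> d k =1 d l.
Hypothesis d_inj : forall k l, ~~ congruent_index m k l ->
  injective (fun w => d k w - d l w)%R.
Hypothesis d1_inj : forall k l, injective (fun w => w + d k w + d l w)%R.

(** If two different forms took the same value x at e, they would agree there with their values at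
    (x, x), so e = (x, x), which is not increasing. *)
Lemma form_injl (K : pred 'I_3) e :
  (forall k l, K k -> K l -> congruent_index m k l -> k = l) ->
  increasing e -> {in cols K &, injective (fun i => affine_form d i e)}.
Proof.
move=> KI ince i j Ki Kj eij; apply/eqP; apply: contraLR ince => ne.
have /(form_inj dN d_inj d1_inj) hI : ~~ same_form (congruent_index m) i j.
  apply: contra ne; case: i j Ki Kj {eij} => [k b] [l c] Kk Kl /andP[/= /eqP-> kl].
  by rewrite (KI k l).
set x := affine_form d i e.
have /hI -> : (fun e => (affine_form d i e, affine_form d j e)) e =
              (fun e => (affine_form d i e, affine_form d j e)) (x, x).
  by rewrite /= !form_diag // -eij.
by rewrite /increasing ltnn.
Qed.

Lemma quad_index_inj k l :
  quad_index k -> quad_index l -> congruent_index m k l -> k = l.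
Proof.
rewrite /quad_index /congruent_index => k2 l2 /eqP kl; apply: val_inj.
by move: kl; rewrite !modn_small //; case/orP: m23 => /eqP->; lia.
Qed.

Lemma duo_index_inj k l :
  duo_index k -> duo_index l -> congruent_index m k l -> k = l.
Proof. by move=> /eqP k2 /eqP l2 _; apply: val_inj; rewrite /= k2 l2. Qed.

Lemma quad_duo_index k : quad_index k -> duo_index k -> False.
Proof. by move=> k2 /eqP k2E; move: k2; rewrite /quad_index k2E. Qed.

Lemma pair_neq (T1 T2 : eqType) (x y : T1 * T2) :
  (x != y) = (x.1 != y.1) || (x.1 == y.1) && (x.2 != y.2).
Proof. by case: x y => a b [a' b']; rewrite xpair_eqE negb_and; case: eqP. Qed.

Section Blowup.

Hypothesis mulrn_inj : forall k, 0 < k < 5 -> injective (fun z : Z => z *+ k)%R.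

Definition blowup_point (i : column) (t : (V * V) * (Z * Z)) : V * Z :=
  (affine_form d i t.1, oa i t.2).

Definition blowup_dom : pred ((V * V) * (Z * Z)) := fun t => increasing t.1.

Definition blowup : seq ({set V * Z} * {set V * Z}) :=
  block_family blowup_dom blowup_point.

Lemma blowup_inj (K : pred 'I_3) t :
  (forall k l, K k -> K l -> congruent_index m k l -> k = l) ->
  t \in blowup_dom -> {in cols K &, injective (blowup_point ^~ t)}.
Proof. by move=> KI inct i j Ki Kj [/(form_injl KI inct Ki Kj)]. Qed.

(** For given e and two distinct columns, exactly one row of the array produces the prescribed
    second coordinates. *)
Lemma sum_blowup (K K' : pred 'I_3) (x y : V * Z) :
  (forall k l, K k -> K l -> congruent_index m k l -> k = l) ->
  (forall k l, K' k -> K' l -> congruent_index m k l -> k = l) ->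
  (forall k, K k -> K' k -> x != y) ->
  \sum_(t in blowup_dom)
     ((x \in column_image blowup_point K t) && (y \in column_image blowup_point K' t)) =
  pair_count d K K' x.1 y.1.
Proof.
move=> KI KI' xy.
rewrite sum_column_image //; first last.
- by move=> t; apply: blowup_inj.
- by move=> t; apply: blowup_inj.
apply: eq_bigr => i _; apply: eq_bigr => j /andP[_ ji].
transitivity (\sum_(e | increasing e) \sum_r
  (blowup_point i (e, r) == x) * (blowup_point j (e, r) == y)).
  by rewrite pair_big; apply: eq_big => -[e r] //; rewrite andbT.
apply: eq_bigr => e _; rewrite /incidence -[RHS]muln1.
rewrite eq_sym in ji; rewrite -(sum_oa mulrn_inj x.2 y.2 ji) big_distrr /=.
apply: eq_bigr => r _; case: x y {xy} => g z [g' z'] /=.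
by rewrite !xpair_eqE -!mulnb mulnACA.
Qed.

End Blowup.

Section Fill.

(** Here the forms live inside a fibre: [Z] indexes the fibres, and the last parameter is the free
    translation of the pair. *)
Definition fill_point (i : column) (t : Z * ((V * V) * V)) : Z * V :=
  (t.1, affine_form d i t.2.1 + (if duo_index i.1 then t.2.2 else 0))%R.

Definition fill_dom : pred (Z * ((V * V) * V)) := fun t => increasing t.2.1.

Definition fill : seq ({set Z * V} * {set Z * V}) :=
  block_family fill_dom fill_point.

Lemma fill_inj (K : pred 'I_3) t :
  (forall k l, K k -> K l -> congruent_index m k l -> k = l) ->
  (forall k l, K k -> K l -> duo_index k = duo_index l) ->
  t \in fill_dom -> {in cols K &, injective (fill_point ^~ t)}.
Proof.
move=> KI KD inct i j Ki Kj [].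
by rewrite (KD _ _ Ki Kj) => /addIr/(form_injl KI inct Ki Kj).
Qed.

(** [sg] and [sg'] tell whether the columns of [K] and [K'] are translated; moving the translation
    over to the points leaves an untranslated count for each k. *)
Lemma sum_fill (K K' : pred 'I_3) (x y : Z * V) (sg sg' : bool) :
  (forall k l, K k -> K l -> congruent_index m k l -> k = l) ->
  (forall k l, K' k -> K' l -> congruent_index m k l -> k = l) ->
  (forall k, K k -> duo_index k = sg) -> (forall k, K' k -> duo_index k = sg') ->
  (forall k, K k -> K' k -> x != y) ->
  \sum_(t in fill_dom)
     ((x \in column_image fill_point K t) && (y \in column_image fill_point K' t)) =
  (x.1 == y.1) * \sum_k pair_count d K K'
    (x.2 - (if sg then k else 0))%R (y.2 - (if sg' then k else 0))%R.
Proof.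
move=> KI KI' sgE sgE' xy.
rewrite sum_column_image //; first last.
- by move=> t; apply: fill_inj => // k l /sgE'-> /sgE'->.
- by move=> t; apply: fill_inj => // k l /sgE-> /sgE->.
rewrite /pair_count [in RHS]exchange_big big_distrr /=; apply: eq_bigr => i Ki.
rewrite [in RHS]exchange_big big_distrr /=; apply: eq_bigr => j /andP[K'j ji].
transitivity (\sum_h \sum_(e | increasing e) \sum_k
  (fill_point i (h, (e, k)) == x) * (fill_point j (h, (e, k)) == y)).
  under [RHS]eq_bigr => h _ do rewrite pair_big.
  by rewrite pair_big; apply: eq_big => -[h [e k]] //; rewrite andbT.
rewrite [LHS]exchange_big; under [LHS]eq_bigr => e _ do rewrite exchange_big.
rewrite [LHS]exchange_big big_distrr /=; apply: eq_bigr => k _.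
rewrite big_distrr /=; apply: eq_bigr => e _.
rewrite /fill_point /= (sgE _ Ki) (sgE' _ K'j) /incidence.
case: x y {xy} => g z [g' z'] /=.
have shift (a b c : V) : (a + b == c)%R = (a == c - b)%R.
  by rewrite [RHS]eq_sym subr_eq eq_sym.
under eq_bigr => h _ do rewrite !xpair_eqE -!mulnb mulnACA !shift.
rewrite -big_distrl /=; congr (_ * _).
  by rewrite (bigD1 g) //= eqxx mul1n big1 ?addn0 // => h /negbTE->.
by rewrite /affine_form !shift.
Qed.

End Fill.

End InflatedFamilies.

(** * Pair counts of the inflated families *)

Definition quad_count (X : finType) (D : seq ({set X} * {set X})) (x y : X) : nat :=
  count (fun b : {set X} * {set X} => (x \in b.1) && (y \in b.1)) D.
Definition duo_count (X : finType) (D : seq ({set X} * {set X})) (x y : X) : nat :=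
  count (fun b : {set X} * {set X} => (x \in b.2) && (y \in b.2)) D.
Definition mixed_count (X : finType) (D : seq ({set X} * {set X})) (x y : X) : nat :=
  count (fun b : {set X} * {set X} => (x \in b.1) && (y \in b.2)) D.

Definition well_sized (X : finType) (b : {set X} * {set X}) : bool :=
  (#|b.1| == 4) && (#|b.2| == 2).

Section Counts.

Variables (V Z : finZmodType) (d : 'I_3 -> V -> V) (m : nat).
Hypothesis m23 : (m == 2) || (m == 3).
Hypothesis dN : forall k w, d k (- w)%R = (- d k w)%R.
Hypothesis d0 : forall k, d k 0%R = 0%R.
Hypothesis coE : forall k l, congruent_index m k l -> d k =1 d l.
Hypothesis d_inj : forall k l, ~~ congruent_index m k l ->
  injective (fun w => d k w - d l w)%R.
Hypothesis d1_inj : forall k l, injective (fun w => w + d k w + d l w)%R.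

Let qI := quad_index_inj m23.
Let dI := @duo_index_inj m.

Lemma card_cols_quad : #|cols quad_index| = 4.
Proof.
by rewrite -sum1_card -(eq_bigl _ _ (fun i => andbT (i \in cols quad_index))) sum_cols
  !big_ord_recl big_ord0 !big_bool.
Qed.

Lemma card_cols_duo : #|cols duo_index| = 2.
Proof.
by rewrite -sum1_card -(eq_bigl _ _ (fun i => andbT (i \in cols duo_index))) sum_cols
  !big_ord_recl big_ord0 !big_bool.
Qed.

Lemma block_family_sized (X J : finType) (U : pred J) (pt : column -> J -> X) :
  (forall t, t \in U -> {in cols quad_index &, injective (pt^~ t)}) ->
  (forall t, t \in U -> {in cols duo_index &, injective (pt^~ t)}) ->
  all (@well_sized X) (block_family U pt).
Proof.
move=> qIn dIn; apply/allP=> b /mapP[t]; rewrite mem_enum => Ut ->.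
by rewrite /well_sized /column_image /= !card_in_imset ?card_cols_quad ?card_cols_duo //;
  [exact: dIn|exact: qIn].
Qed.

Section BlowupCounts.

Hypothesis mulrn_inj : forall k, 0 < k < 5 -> injective (fun z : Z => z *+ k)%R.
Let D : seq ({set V * Z} * {set V * Z}) := blowup Z d.

Lemma blowup_sized : all (@well_sized _) D.
Proof.
apply: block_family_sized => t; first exact: (blowup_inj dN d0 d_inj d1_inj qI).
exact: (blowup_inj dN d0 d_inj d1_inj dI).
Qed.

Lemma blowup_quad x y : x != y -> quad_count D x y = 6 * (x.1 != y.1).
Proof.
move=> xy; rewrite /quad_count count_block_family (sum_blowup dN d0 d_inj d1_inj) //.
by rewrite (@pair_count_quad _ _ m).
Qed.

Lemma blowup_duo x y : x != y -> duo_count D x y = (x.1 != y.1).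
Proof.
move=> xy; rewrite /duo_count count_block_family (sum_blowup dN d0 d_inj d1_inj) //.
by rewrite (@pair_count_duo _ _ m).
Qed.

Lemma blowup_mixed x y :
  mixed_count D x y = pair_count d quad_index duo_index x.1 y.1.
Proof.
rewrite /mixed_count count_block_family (sum_blowup dN d0 d_inj d1_inj) //.
by move=> k kq /(quad_duo_index kq).
Qed.

End BlowupCounts.

Section FillCounts.

Let D : seq ({set Z * V} * {set Z * V}) := fill Z d.

Lemma fill_sized : all (@well_sized _) D.
Proof.
apply: block_family_sized => t.
  apply: (fill_inj dN d0 d_inj d1_inj qI) => k l; rewrite /quad_index /duo_index.
  by move=> /ltn_eqF-> /ltn_eqF->.
by apply: (fill_inj dN d0 d_inj d1_inj dI) => k l -> ->.
Qed.

(** Translations move only the pair, so every quadruple is repeated |V| times. *)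
Lemma fill_quad x y : x != y -> quad_count D x y = 6 * #|V| * (x.1 == y.1).
Proof.
move=> xy; rewrite /quad_count count_block_family.
rewrite (sum_fill (sg := false) (sg' := false) dN d0 d_inj d1_inj) //; first last.
- by move=> k /ltn_eqF.
- by move=> k /ltn_eqF.
under eq_bigr => k _ do rewrite (@pair_count_quad _ _ m) // !subr0.
rewrite sum_nat_const; move: xy; rewrite pair_neq; case: eqP => _ /=; last by rewrite muln0.
by move=> ->; rewrite muln1 mul1n mulnC.
Qed.

Lemma fill_duo x y : x != y -> duo_count D x y = #|V| * (x.1 == y.1).
Proof.
move=> xy; rewrite /duo_count count_block_family.
rewrite (sum_fill (sg := true) (sg' := true) dN d0 d_inj d1_inj) //.
under eq_bigr => k _ do rewrite (@pair_count_duo _ _ m) // (inj_eq (addIr _)).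
rewrite sum_nat_const; move: xy; rewrite pair_neq; case: eqP => _ /=; last by rewrite muln0.
by move=> ->; rewrite !muln1 mul1n.
Qed.

(** The translation carries y through the whole fibre, so [sum_pair_count_mixed] applies and x = y
    is no longer exceptional. *)
Lemma fill_mixed x y : mixed_count D x y = 4 * #|V|.-1 * (x.1 == y.1).
Proof.
rewrite /mixed_count count_block_family.
rewrite (sum_fill (sg := false) (sg' := true) dN d0 d_inj d1_inj) //; first last.
- by move=> k kq /(quad_duo_index kq).
- by move=> k /ltn_eqF.
rewrite mulnC -(sum_pair_count_mixed (m := m) dN d0 coE d_inj d1_inj x.2); congr (_ * _).
rewrite [RHS](reindex_inj (h := fun k => y.2 - k)%R); last by move=> a b /addrI/oppr_inj.
by apply: eq_bigr => k _; rewrite subr0.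
Qed.

End FillCounts.

End Counts.

(** * Assembling two families into a design on two groups *)

Section Assembly.

Variable X : finType.
Variables DA DB : seq ({set X} * {set X}).
Variables l1 l2 : nat.
Hypothesis X_gt0 : 0 < #|X|.
Hypothesis DA_sized : all (@well_sized X) DA.
Hypothesis DB_sized : all (@well_sized X) DB.
Hypothesis AA : forall x y, x != y -> quad_count DA x y + duo_count DB x y = l1.
Hypothesis BB : forall x y, x != y -> quad_count DB x y + duo_count DA x y = l1.
Hypothesis AB : forall x y, mixed_count DA x y + mixed_count DB y x = l2.

Definition side (s : bool) : {set bool * X} := [set t | t.1 == s].

Definition sides : {set {set bool * X}} := [set side s | s : bool].

(** [s] names the side that receives the quadruple: [false] for [DA] and [true] for [DB], which is
    how [AA], [BB] and [AB] are to be read. *)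
Definition block (s : bool) (b : {set X} * {set X}) : {set bool * X} :=
  [set t | t.2 \in (if t.1 == s then b.1 else b.2)].

Definition design : seq {set bool * X} :=
  [seq block false b | b <- DA] ++ [seq block true b | b <- DB].

Lemma side_inj : injective side.
Proof.
move=> s s'; have [x _] : exists x : X, x \in X by apply/card_gt0P.
by move/setP/(_ (s, x)); rewrite !inE /= eqxx => /esym/eqP.
Qed.

Lemma card_block_side s b s' :
  #|block s b :&: side s'| = if s' == s then #|b.1| else #|b.2|.
Proof.
rewrite -(fun_if (fun A : {set X} => #|A|)).
set A := (if _ then _ else _).
rewrite -(@card_imset _ _ (pair s') A) => [|x y []//].
apply: eq_card => -[t x]; rewrite !inE /=.
apply/andP/imsetP => [[xb /eqP ts]|[y yb [-> ->]]]; last by rewrite eqxx.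
by exists x; rewrite ?ts // /A -ts.
Qed.

Lemma block_sized b : b \in design ->
  exists s, #|b :&: side s| = 2 /\ #|b :&: side (~~ s)| = 4.
Proof.
rewrite mem_cat => /orP[/mapP[c cA ->]|/mapP[c cB ->]].
  have /andP[/eqP c4 /eqP c2] := allP DA_sized _ cA.
  by exists true; rewrite !card_block_side /= c2 c4.
have /andP[/eqP c4 /eqP c2] := allP DB_sized _ cB.
by exists false; rewrite !card_block_side /= c2 c4.
Qed.

Lemma card_block b : b \in design -> #|b| = 6.
Proof.
move=> /block_sized[s [b2 b4]]; rewrite -(cardsID (side s) b) b2.
suff -> : b :\: side s = b :&: side (~~ s) by rewrite b4.
by apply/setP=> -[t x]; rewrite !inE /= andbC; case: s t {b2 b4} => [] [].
Qed.

Lemma count_design (p : pred {set bool * X}) :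
  count p design =
  count (fun b => p (block false b)) DA + count (fun b => p (block true b)) DB.
Proof. by rewrite count_cat !count_map. Qed.

Lemma design_same_side s x y : x != y ->
  count (fun b : {set bool * X} => ((s, x) \in b) && ((s, y) \in b)) design = l1.
Proof.
move=> xy; rewrite count_design; case: s.
  rewrite addnC -(BB xy); congr addn; apply: eq_count => b; by rewrite /block !inE.
by rewrite -(AA xy); congr addn; apply: eq_count => b; rewrite /block !inE.
Qed.

Lemma design_diff_side s x y :
  count (fun b : {set bool * X} => ((s, x) \in b) && ((~~ s, y) \in b)) design = l2.
Proof.
rewrite count_design; case: s.
  by rewrite -(AB y x); congr addn; apply: eq_count => b; rewrite /block !inE // andbC.
by rewrite -(AB x y); congr addn; apply: eq_count => b; rewrite /block !inE // andbC.
Qed.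

(* Counting flags through a point: each block through it contains five more points. *)
Lemma design_replication (t : bool * X) :
  count (fun b : {set bool * X} => t \in b) design * 5 =
  #|X|.-1 * l1 + #|X| * l2.
Proof.
pose pairs (u : bool * X) := count (fun b : {set bool * X} => (t \in b) && (u \in b)) design.
have sum_pairs : \sum_u pairs u = count (fun b : {set bool * X} => t \in b) design * 6.
  rewrite /pairs; under eq_bigr => u _ do rewrite -sum1_count big_mkcond /=.
  rewrite exchange_big -[in RHS]sum1_count [in RHS]big_mkcond big_distrl /=.
  rewrite big_seq [RHS]big_seq; apply: eq_bigr => b bD.
  case: (t \in b); last by rewrite big1 // mul0n.
  by rewrite -big_mkcond sum1_card card_block.
have pairs_t : pairs t = count (fun b : {set bool * X} => t \in b) design.
  by apply: eq_count => b; rewrite andbb.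
rewrite (bigD1 t) //= pairs_t in sum_pairs.
suff <- : \sum_(u | u != t) pairs u = #|X|.-1 * l1 + #|X| * l2.
  by move: sum_pairs; rewrite mulnSr addnC => /addIn.
case: t @pairs {sum_pairs pairs_t} => s x pairs.
have splitE : \sum_(u | u != (s, x)) pairs u =
    \sum_(y | y != x) pairs (s, y) + \sum_y pairs (~~ s, y).
  rewrite (bigID (fun u => u.1 == s)) /=; congr addn.
    rewrite (reindex_onto (pair s) snd) /= => [|[s' y] /andP[_ /eqP /= ->]//].
    by apply: eq_bigl => y; rewrite xpair_eqE !eqxx /= !andbT.
  rewrite (reindex_onto (pair (~~ s)) snd) /= => [|[s' y] /andP[_ /=]]; last first.
    by case: (s) s' => [] [].
  by apply: eq_bigl => y; rewrite xpair_eqE eqxx andbT; case: (s).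
rewrite splitE; congr addn.
  under eq_bigr => y yx do rewrite /pairs design_same_side 1?eq_sym //.
  by rewrite sum_nat_const cardC1.
under eq_bigr => y _ do rewrite /pairs design_diff_side.
by rewrite sum_nat_const.
Qed.

Lemma design_is_GDD : is_GDD #|X| 2 6 l1 l2 sides design.
Proof.
have partE : partition sides [set: bool * X].
  apply/and3P; split.
  - rewrite eqEsubset subsetT; apply/subsetP => -[s x] _; apply/bigcupP.
    by exists (side s); rewrite ?inE ?imset_f.
  - apply/trivIsetP => _ _ /imsetP[s _ ->] /imsetP[s' _ ->] ne.
    rewrite disjoints_subset; apply/subsetP => -[u x]; rewrite !inE /= => /eqP ->.
    by apply: contra ne => /eqP ->.
  apply/imsetP => -[s _ /setP]; have [x _] : exists x : X, x \in X by apply/card_gt0P.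
  by move/(_ (s, x)); rewrite !inE eqxx.
split=> //.
- by rewrite card_prod card_bool.
- by rewrite card_imset ?card_bool //; apply: side_inj.
- move=> _ /imsetP[s _ ->].
  rewrite -[RHS](@card_imset _ _ (pair s)) => [|x y []//].
  apply: eq_card => -[t x]; rewrite !inE /=.
  by apply/eqP/imsetP => [->|[y _ [-> _]]//]; exists x.
- by move=> b; exact: card_block.
(* The division is exact, since [design_replication] evaluates 5 r. *)
- exists ((#|X|.-1 * l1 + #|X| * l2) %/ 5) => t.
  by rewrite -(design_replication t) mulnK.
- move=> _ [s x] [s' y] /imsetP[r _ ->]; rewrite !inE /= => /eqP-> /eqP->.
  rewrite xpair_eqE eqxx /= => xy; exact: design_same_side.
move=> _ _ [s x] [s' y] /imsetP[r _ ->] /imsetP[r' _ ->] ne.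
rewrite !inE /= => /eqP-> /eqP->.
have -> : r' = ~~ r by case: r r' ne => [] []; rewrite ?eqxx.
exact: design_diff_side.
Qed.

Lemma design_configuration : has_configuration 2 4 sides design.
Proof.
move=> b /block_sized[s [b2 b4]]; exists (side s), (side (~~ s)).
by rewrite !imset_f // (inj_eq side_inj) b2 b4; split=> //; case: (s).
Qed.

End Assembly.

(** * Choice of coefficients *)

Lemma Zp_mulrn_inj f k : coprime f.+1 k -> injective (fun z : 'I_f.+1 => z *+ k)%R.
Proof.
move=> fk x y xy; apply/eqP; rewrite -subr_eq0; apply/eqP.
have : ((x - y) *+ k = 0)%R by rewrite mulrnBl xy subrr.
move: (x - y)%R => z; rewrite Zp_mulrn => /(congr1 val) /= /eqP.
rewrite -/(dvdn _ _) Gauss_dvdl // => fz; apply: val_inj => /=.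
by apply/eqP; move: fz; rewrite /dvdn modn_small.
Qed.

Lemma exists_notin (T : finType) (s : seq T) : size s < #|T| -> exists x, x \notin s.
Proof.
move=> sT; apply/existsP; apply: contraTT sT; rewrite negb_exists -leqNgt => /forallP s_all.
apply: leq_trans (card_size s); apply/subset_leq_card/subsetP => x _.
by have := s_all x; rewrite negbK.
Qed.

(** Coefficients 0, 1, 0, which follow the pattern m = 2; all 1 + c_k + c_l then lie in {1, 2,
    3}. *)
Definition int_scale (Z : finZmodType) (k : 'I_3) (w : Z) : Z := (w *+ (k %% 2))%R.

Definition field_scale (F : finFieldType) (c : 'I_3 -> F) (k : 'I_3) (w : F) : F :=
  (c k * w)%R.

(** * The construction on F x Z *)

Section Construction.

Variables (F : finFieldType) (Z : finZmodType) (v : nat).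
Hypothesis F2 : 2 \in [pchar F]%R.
Hypothesis F_card : #|F| = 8 * v.
Hypothesis v_gt0 : 0 < v.
Hypothesis mulrn_inj : forall k, 0 < k < 5 -> injective (fun z : Z => z *+ k)%R.

Lemma field_scale_inj (c : 'I_3 -> F) m :
  (forall k l, ~~ congruent_index m k l -> c k != c l) ->
  forall k l, ~~ congruent_index m k l ->
  injective (fun w => field_scale c k w - field_scale c l w)%R.
Proof.
move=> cI k l /cI; rewrite -subr_eq0 => kl x y.
by rewrite /field_scale -!mulrBl => /(mulfI kl).
Qed.

(** In characteristic 2 the factor 1 + c_k + c_l vanishes only if c_l = 1 + c_k. *)
Lemma field_scale1_inj (c : 'I_3 -> F) :
  (forall k l, c l != 1 + c k)%R ->
  forall k l, injective (fun w => w + field_scale c k w + field_scale c l w)%R.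
Proof.
move=> cI k l x y; rewrite /field_scale -{1}[x]mul1r -{1}[y]mul1r -!mulrDl.
by apply: mulfI; rewrite addr_eq0 (oppr_pchar2 F2) eq_sym.
Qed.

Lemma int_scale_eq k l : congruent_index 2 k l -> @int_scale Z k =1 int_scale l.
Proof. by move=> /eqP kl w; rewrite /int_scale kl. Qed.

Lemma int_scale_inj k l : ~~ congruent_index 2 k l ->
  injective (fun w : Z => int_scale k w - int_scale l w)%R.
Proof.
rewrite /congruent_index /int_scale !modn2 => kl x y.
by case: (odd k) (odd l) kl => [] [] //= _; rewrite ?subr0 ?sub0r // => /oppr_inj.
Qed.

Lemma int_scale1_inj (k l : 'I_3) :
  injective (fun w : Z => w + int_scale k w + int_scale l w)%R.
Proof.
move=> x y; rewrite /int_scale -{1}[x]mulr1n -{1}[y]mulr1n -!mulrnDr.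
by apply: mulrn_inj; rewrite !modn2; case: (odd k) (odd l) => [] [].
Qed.

Lemma forall_I3 (P : 'I_3 -> Prop) :
  P ord0 -> P (lift ord0 ord0) -> P ord_max -> forall k, P k.
Proof.
move=> P0 P1 P2 [[|[|[|k]]] k3] //.
- by rewrite (_ : Ordinal k3 = ord0) //; apply: val_inj.
- by rewrite (_ : Ordinal k3 = lift ord0 ord0) //; apply: val_inj.
- by rewrite (_ : Ordinal k3 = ord_max) //; apply: val_inj.
Qed.

(** The default value of [nth] is the third coefficient c_2 = 0, which makes the pair of a block {x,
    y} itself. *)
Definition coef (c0 c1 : F) (k : 'I_3) : F := nth 0%R [:: c0; c1] k.

Lemma coef_neq_succ (c0 c1 : F) :
  (c0 != 1)%R -> (c1 != 1)%R -> (c1 != 1 + c0)%R ->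
  forall k l, (coef c0 c1 l != 1 + coef c0 c1 k)%R.
Proof.
move=> c01 c11 c10 k l; have succ0 (x : F) : (x != 1 + x)%R.
  by rewrite -subr_eq0 opprD addrCA subrr addr0 oppr_eq0 oner_eq0.
(* In characteristic 2 the condition is symmetric in k and l, so three inequalities cover all
   off-diagonal cases. *)
have swap (x y : F) : (x != 1 + y)%R = (y != 1 + x)%R.
  by congr negb; apply/eqP/eqP => ->; rewrite addrA (addrr_pchar2 F2) add0r.
move: k l; apply: forall_I3; apply: forall_I3; rewrite /coef /= ?addr0 ?succ0 //.
- by rewrite swap addr0.
- by rewrite swap.
- by rewrite swap addr0.
- by rewrite eq_sym oner_eq0.
Qed.

Lemma exists_GDD : exists (T : finType) (groups : {set {set T}}) (blocks : seq {set T}),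
    is_GDD #|{: F * Z}| 2 6 (7 * (v * #|Z|)) (8 * (v * #|Z|) - 1) groups blocks /\
    has_configuration 2 4 groups blocks.
Proof.
(* The excluded values are the earlier coefficients, starting with c_2 = 0, and their successors; at
   most four of at least eight elements are lost. *)
have [c0 c0N] : exists c0 : F, c0 \notin [:: 0; 1]%R.
  by apply: exists_notin; rewrite F_card /=; lia.
have [c1 c1N] : exists c1 : F, c1 \notin [:: 0; 1; c0; 1 + c0]%R.
  by apply: exists_notin; rewrite F_card /=; lia.
move: c0N c1N; rewrite !inE !negb_or => /andP[c00 c01] /and4P[c10 c11 c1c0 c1s].
have dN (c : 'I_3 -> F) k w : (field_scale c k (- w) = - field_scale c k w)%R by apply: mulrN.
have d0 (c : 'I_3 -> F) k : (field_scale c k 0 = 0)%R by apply: mulr0.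
have zN k (w : Z) : (int_scale k (- w) = - int_scale k w)%R by apply: mulNrn.
have z0 k : (int_scale k 0 = 0 :> Z)%R by apply: mul0rn.
have d3E k l : congruent_index 3 k l -> field_scale (coef c0 c1) k =1 field_scale (coef c0 c1) l.
  by rewrite /congruent_index !modn_small // => /eqP/val_inj->.
have d2E k l : congruent_index 2 k l -> field_scale (coef 0%R c1) k =1 field_scale (coef 0%R c1) l.
  by move: k l; apply: forall_I3; apply: forall_I3.
have d3I : forall k l, ~~ congruent_index 3 k l ->
    injective (fun w => field_scale (coef c0 c1) k w - field_scale (coef c0 c1) l w)%R.
  apply: field_scale_inj; apply: forall_I3; apply: forall_I3 => // _;
  by rewrite /coef /= // eq_sym.
have d2I : forall k l, ~~ congruent_index 2 k l ->
    injective (fun w => field_scale (coef 0%R c1) k w - field_scale (coef 0%R c1) l w)%R.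
  apply: field_scale_inj; apply: forall_I3; apply: forall_I3 => // _;
  by rewrite /coef /= // eq_sym.
have d31 := field_scale1_inj (coef_neq_succ c01 c11 c1s).
have d21 : forall k l, injective
    (fun w => w + field_scale (coef 0%R c1) k w + field_scale (coef 0%R c1) l w)%R.
  by apply/field_scale1_inj/coef_neq_succ; rewrite ?addr0 // eq_sym oner_eq0.
pose regular := blowup Z (field_scale (coef c0 c1)).
pose special := blowup Z (field_scale (coef 0%R c1)).
pose fibres := fill F (@int_scale Z).
pose u := v * #|Z|.
(* On one side, points in different fibres meet 6u + u = 7u times; within a fibre, v copies of
   [fibres] give 6v|Z| + v|Z| = 7u. *)
pose DA := flatten (nseq u regular) ++ flatten (nseq v fibres).
pose DB := flatten (nseq u.-1 regular) ++ special ++ flatten (nseq v fibres).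
have Z_gt0 : 0 < #|Z| by apply/card_gt0P; exists 0%R.
have u_gt0 : 0 < u by rewrite muln_gt0 v_gt0.
have all_nseq (X : finType) m (s : seq ({set X} * {set X})) :
    all (@well_sized X) s -> all (@well_sized X) (flatten (nseq m s)).
  by move=> /allP s_ok; apply/allP => b /mem_flatten_nseq/s_ok.
have reg_ok : all (@well_sized _) regular by apply: (@blowup_sized _ _ _ 3).
have spec_ok : all (@well_sized _) special by apply: (@blowup_sized _ _ _ 2).
have fib_ok : all (@well_sized _) fibres.
  by apply: (@fill_sized _ _ _ 2) => //; [exact: int_scale_inj|exact: int_scale1_inj].
have regQ : forall x y, x != y -> quad_count regular x y = 6 * (x.1 != y.1).
  exact: (@blowup_quad _ _ _ 3).
have specQ : forall x y, x != y -> quad_count special x y = 6 * (x.1 != y.1).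
  exact: (@blowup_quad _ _ _ 2).
have regD : forall x y, x != y -> duo_count regular x y = (x.1 != y.1).
  exact: (@blowup_duo _ _ _ 3).
have specD : forall x y, x != y -> duo_count special x y = (x.1 != y.1).
  exact: (@blowup_duo _ _ _ 2).
have regM x y : mixed_count regular x y = 4 * (x.1 != y.1).
  by rewrite (@blowup_mixed _ _ _ 3) // (@pair_count_mixed3 _ _ 3).
have specM x y : mixed_count special x y = if x.1 == y.1 then #|F|.-1 else 3.
  by rewrite (@blowup_mixed _ _ _ 2) // (@pair_count_mixed2 _ _ 2).
have fibQ : forall x y, x != y -> quad_count fibres x y = 6 * #|Z| * (x.1 == y.1).
  by apply: (@fill_quad _ _ _ 2) => //;
    [exact: int_scale_eq|exact: int_scale_inj|exact: int_scale1_inj].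
have fibD : forall x y, x != y -> duo_count fibres x y = #|Z| * (x.1 == y.1).
  by apply: (@fill_duo _ _ _ 2) => //;
    [exact: int_scale_eq|exact: int_scale_inj|exact: int_scale1_inj].
have fibM x y : mixed_count fibres x y = 4 * #|Z|.-1 * (x.1 == y.1).
  by apply: (@fill_mixed _ _ _ 2) => //;
    [exact: int_scale_eq|exact: int_scale_inj|exact: int_scale1_inj].
exists (bool * (F * Z))%type, (sides (F * Z)%type), (design DA DB); split; last first.
  by apply: design_configuration; rewrite ?all_cat ?all_nseq ?spec_ok // card_prod F_card;
    rewrite muln_gt0 Z_gt0 muln_gt0 v_gt0.
apply: design_is_GDD.
- by rewrite card_prod F_card muln_gt0 Z_gt0 muln_gt0 v_gt0.
- by rewrite all_cat !all_nseq.
- by rewrite !all_cat !all_nseq // spec_ok.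
- move=> x y xy; rewrite /quad_count /duo_count !count_cat !count_flatten_nseq.
  rewrite -!/(quad_count _ x y) -!/(duo_count _ x y).
  rewrite (regQ _ _ xy) (regD _ _ xy) (specD _ _ xy) (fibQ _ _ xy) (fibD _ _ xy).
  case: (x.1 =P y.1) => _ /=; rewrite ?muln0 ?muln1 ?[v * (6 * _)]mulnCA -/u;
    by move: u_gt0; move: (u) => w; clear; lia.
- move=> x y xy; rewrite /quad_count /duo_count !count_cat !count_flatten_nseq.
  rewrite -!/(quad_count _ x y) -!/(duo_count _ x y).
  rewrite (regQ _ _ xy) (regD _ _ xy) (specQ _ _ xy) (fibQ _ _ xy) (fibD _ _ xy).
  case: (x.1 =P y.1) => _ /=; rewrite ?muln0 ?muln1 ?[v * (6 * _)]mulnCA -/u;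
    by move: u_gt0; move: (u) => w; clear; lia.
(* Across the sides: 4u + 4(u - 1) + 3 = 8u - 1 for different fibres, and (8v - 1) + 8(u - v) = 8u -
   1 for equal ones. *)
move=> x y; rewrite /mixed_count !count_cat !count_flatten_nseq.
rewrite -!/(mixed_count _ x y) -!/(mixed_count _ y x) !regM specM !fibM.
rewrite ![y.1 == x.1]eq_sym F_card.
case: (x.1 =P y.1) => _ /=; rewrite ?muln0 ?muln1 ?[v * (4 * _)]mulnCA -/u; last first.
  by move: u_gt0; move: (u) => w; clear; lia.
have -> : v * #|Z|.-1 = u - v by rewrite -subn1 mulnBr muln1.
have : v <= u by rewrite leq_pmulr.
by move: v_gt0 u_gt0; move: (u) => w; clear; lia.
Qed.

End Construction.

(** * Splitting n into its power of 2 and its odd part *)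

Theorem theorem5p6 (n : nat) (n_gt0 : 0 < n) (n_mod : n = 16 %[mod 24]) :
  exists (T : finType) (groups : {set {set T}}) (blocks : seq {set T}),
    is_GDD n 2 6 ((7 * n) %/ 8) (n - 1) groups blocks /\
    has_configuration 2 4 groups blocks.
Proof.
have n8 : 2 ^ 3 %| n by lia.
have n3 : ~~ (3 %| n) by lia.
have k3 : 2 < logn 2 n by rewrite -pfactor_dvdn.
have nE : n = 2 ^ logn 2 n * n`_2^' by rewrite -p_part partnC.
have k_gt0 : 0 < logn 2 n by rewrite (ltn_trans _ k3).
have [F F2 F_card] := pPrimePowerField (isT : prime 2) k_gt0.
have F_card8 : #|F| = 8 * 2 ^ (logn 2 n - 3) by rewrite F_card -(expnD 2 3) subnKC.
have f_odd : coprime n`_2^' 2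
  by rewrite coprime_sym (@pnat_coprime 2) ?pnat_id ?part_pnat.
have f3 : coprime n`_2^' 3.
  rewrite coprime_sym prime_coprime //; apply: contra n3 => /dvdn_trans; apply.
  exact: dvdn_part.
have f_gt0 : 0 < n`_2^' by exact: part_gt0.
set f := n`_2^' in nE f_odd f3 f_gt0.
(* Writing f as a successor gives the ordinals their group structure; 1 to 4 are units modulo f,
   which is prime to 2 and 3. *)
have mulI k : 0 < k < 5 -> injective (fun z : 'I_f.-1.+1 => z *+ k)%R.
  move=> k5; apply: Zp_mulrn_inj; rewrite prednK //.
  have : k \in [:: 1; 2; 3; 4] by case: k k5 => [|[|[|[|[|k]]]]].
  rewrite !inE => /or4P[]/eqP-> //; first exact: coprimen1.
  by rewrite (coprimeXr 2 f_odd).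
have v_gt0 : 0 < 2 ^ (logn 2 n - 3) by rewrite expn_gt0.
have := exists_GDD F2 F_card8 v_gt0 mulI.
have n8E : n = 8 * (2 ^ (logn 2 n - 3) * f).
  by rewrite [LHS]nE mulnA -F_card8 F_card.
have -> : (7 * n) %/ 8 = 7 * (2 ^ (logn 2 n - 3) * f) by rewrite {1}n8E mulnCA mulKn.
by rewrite card_prod F_card card_ord prednK // -nE -n8E.
Qed.
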